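(* For every integer $d\geq 0$ and every $\alpha\in\mathbb{C}$ with $\alpha\neq 0$, one has $\nabla(d,\alpha)\neq 0$, where $\nabla(d,\alpha)=\det\left(c_{i,j}\right)_{1\leq i,j\leq d+1}$ is the determinant of the $(d+1)\times(d+1)$ matrix with entries $$c_{i,j}=\begin{cases}3(d+1)^{2}\alpha^{2} & \text{if } j=i,\\ -4(d-i+2)(d+1)\alpha^{3} & \text{if } j=i-1,\\ -3i(d+1)\alpha & \text{if } j=i+1,\\ i(i+1) & \text{if } j=i+2,\\ 0 & \text{otherwise.}\end{cases}$$ *)

(* Defs.v *)
From mathcomp Require Import all_boot all_order all_algebra.
From mathcomp Require Import reals complex.

Set Implicit Arguments.
Unset Strict Implicit.
Unset Printing Implicit Defensive.

Import GRing.Theory.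

Local Open Scope ring_scope.

(* Entries are indexed by i, j >= 1. The factor d - i + 2 is computed in the
   complex field, so no truncated subtraction on nat is involved. *)
Definition nabla_coef (R : realType) (d : nat) (alpha : R[i]) (i j : nat)
  : R[i] :=
  if j == i then 3 * d.+1%:R ^+ 2 * alpha ^+ 2
  else if j.+1 == i then - 4 * (d%:R - i%:R + 2) * d.+1%:R * alpha ^+ 3
  else if j == i.+1 then - 3 * i%:R * d.+1%:R * alpha
  else if j == i.+2 then i%:R * i.+1%:R
  else 0.

(* Ordinals start at 0, hence the shift to indices in 1..d+1. *)
Definition nabla_mx (R : realType) (d : nat) (alpha : R[i]) : 'M[R[i]]_d.+1 :=
  \matrix_(i < d.+1, j < d.+1) nabla_coef d alpha i.+1 j.+1.

Definition nabla (R : realType) (d : nat) (alpha : R[i]) : R[i] :=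
  \det (nabla_mx d alpha).

(* Main.v *)
From mathcomp Require Import boolp normedtype derive sequences.
From mathcomp.analysis Require Import exp.
Require Import Defs.
From mathcomp Require Import all_boot all_order all_algebra.
From mathcomp Require Import reals complex.
From mathcomp Require Import polyrcf ring lra zify.

Import Order.TTheory GRing.Theory Num.Theory numFieldNormedType.Exports.
Local Open Scope ring_scope.

(** Why the determinant does not vanish.  Put n = d + 1.

    A vector in the kernel of the matrix, rescaled by powers of 2 alpha, is the
    coefficient vector of a nonzero polynomial P of degree at most d with
      4 P'' + 2 n (X^2 - 3) P' + (3 n^2 - 2 n d X) P = 0,
    a triconfluent Heun equation in which alpha no longer occurs
    ([nabla_eq0_heun]).  The equation has real coefficients, so the real or the
    imaginary part of P is a nonzero real solution ([heun_real_solution]).  It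
    remains to see that a real polynomial solution P is zero
    ([heun_poly_eq0]).

    Put X = 1 + t and y = exp (Phi) P with Phi' = (n / 4) (t^2 + 2 t - 2).  The
    equation becomes y'' = (n^2 / 16) t^3 (t + 4) y: the point t = 0 is a triple
    turning point.  Follow y on the ray t = w r, r >= 0, with w = exp (i pi / 3).
    There Re Phi tends to - oo like - n r^3 / 12, so y decays, and in the
    variable r
      y'' = (n^2 / 16) (r^4 + 4 r^3 conj w) y.
    Hence the energy h = Re ((1 + w) conj y y') has derivative
      h' = (3 / 2) (|y'|^2 + (n^2 / 16) (r^4 + 4 r^3) |y|^2) >= 0,
    because 1 + w and (1 + w) conj w = 2 - w both have real part 3 / 2.  At
    r = 0 both y and dy / dt are real, so that h is a multiple of
    Re ((1 + w) w) = 0.  Thus h increases from 0 and tends to 0, so it is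
    constant, its derivative vanishes, and so does y on the whole ray.

    The exponential is kept out of the algebra: up to a constant,
    h = exp (2 Re Phi) H with a polynomial H, and H satisfies
    H' = K + E' H with K >= 0 on the half line and E = - 2 Re Phi.  The growth
    argument for h is [eq0_of_deriv_ge] for H: the integrating factor
    gives H >= 0, while comparing leading coefficients in K = H' - E' H gives
    H <= 0 near infinity. *)

(** * Polynomials satisfying a differential inequality *)

(** The integrating factor: the derivative of H exp(- E) is nonnegative. *)
Lemma ge0_of_deriv_ge (R : realType) (E H : {poly R}) :
  H.[0] = 0 -> (forall x, 0 <= x -> E^`().[x] * H.[x] <= H^`().[x]) ->
  forall x, 0 <= x -> 0 <= H.[x].
Proof.
move=> H0 dH x x0.
pose F y := H.[y] * expR (- E.[y]).
have dF (y : R) : is_derive y 1 F ((H^`().[y] - E^`().[y] * H.[y]) * expR (- E.[y])).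
  have -> : F = horner H \* (expR \o horner (- E)).
    by apply/funext => z; rewrite /F /= hornerN.
  apply: is_derive_eq; rewrite /= derivN !hornerN /GRing.scale /=; ring.
suff : F 0 <= F x by rewrite /F H0 mul0r pmulr_lge0 ?expR_gt0.
apply: (@ger0_derive1_ndecr _ F 0 x) => //.
- move=> y; rewrite in_itv /= => /andP[y0 _]; have := dF y => dFy.
  by rewrite derive1E derive_val mulr_ge0 ?expR_ge0 // subr_ge0 dH ?ltW.
- apply: derivable_within_continuous => y _; exact: ex_derive.
Qed.

Lemma lead_coef_ge0 (R : rcfType) (p : {poly R}) :
  (forall x, 0 <= x -> 0 <= p.[x]) -> 0 <= lead_coef p.
Proof.
move=> p0; rewrite leNgt -oppr_gt0 -lead_coefN; apply/negP => lc.
have [a aP] := poly_pinfty_gt_lc lc.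
have := lt_le_trans lc (aP (Num.max 0 a) _).
rewrite le_max lexx orbT hornerN oppr_gt0 => /(_ isT).
by rewrite ltNge p0 // le_max lexx.
Qed.

(** By [ge0_of_deriv_ge] both H and H' - E' H are nonnegative on the half line,
    hence so are their leading coefficients.  As E' H dominates H', these
    leading coefficients are c and - e c with e > 0. *)
Lemma eq0_of_deriv_ge (R : realType) (E H : {poly R}) :
  0 < lead_coef E^`() ->
  H.[0] = 0 -> (forall x, 0 <= x -> E^`().[x] * H.[x] <= H^`().[x]) ->
  H = 0.
Proof.
move=> lE H0 dH; apply/eqP/negPn/negP => Hn0.
have E0 : E^`() != 0 by rewrite -lead_coef_eq0 gt_eqF.
have lH : 0 <= lead_coef H by apply: lead_coef_ge0; exact: ge0_of_deriv_ge dH.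
have : 0 <= lead_coef (H^`() - E^`() * H).
  by apply: lead_coef_ge0 => x x0; rewrite !hornerE subr_ge0 dH.
have sz : (size H^`() < size (- (E^`() * H)))%N.
  rewrite size_polyN size_mul // (leq_trans (lt_size_deriv Hn0)) //.
  by rewrite -[size E^`()]prednK ?size_poly_gt0 // addSn leq_addl.
rewrite lead_coefDr // lead_coefN lead_coefM oppr_ge0 pmulr_rle0 // => lH'.
by move: Hn0; rewrite -lead_coef_eq0 eq_le lH lH'.
Qed.

Lemma eq0_of_horner_nat (F : numDomainType) (p : {poly F}) :
  (forall k, p.[k.+1%:R] = 0) -> p = 0.
Proof.
move=> p0; apply/eqP/negPn/negP => /max_poly_roots.
move=> /(_ [seq k.+1%:R | k <- iota 0 (size p)]).
rewrite size_map size_iota ltnn => H; suff: false by []; apply: H.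
  by apply/allP => _ /mapP[k _ ->]; apply/rootP.
by rewrite map_inj_uniq ?iota_uniq // => a b /eqP; rewrite eqr_nat => /eqP [].
Qed.

(** * From the kernel of the matrix to a differential equation *)

(** The argument is twice the variable of the generating polynomial suggested by
    the matrix: this makes the turning point X = 1 and all coefficients
    integers. *)
Definition heun (F : comNzRingType) (d : nat) (P : {poly F}) : {poly F} :=
  4%:R * P^`()^`() + 2%:R * d.+1%:R * ('X^2 - 3%:R) * P^`()
  + (3%:R * d.+1%:R ^+ 2 - 2%:R * d.+1%:R * d%:R * 'X) * P.
Arguments heun {F}.

Lemma coef_heun (F : comNzRingType) (d : nat) (P : {poly F}) (k : nat) :
  (heun d P)`_k = 4%:R * k.+1%:R * k.+2%:R * P`_k.+2
    - 6%:R * d.+1%:R * k.+1%:R * P`_k.+1 + 3%:R * d.+1%:R ^+ 2 * P`_k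
    + (if k is l.+1 then 2%:R * d.+1%:R * (l%:R - d%:R) * P`_l else 0).
Proof.
have -> : heun d P = P^`()^`() *+ 4 - P^`() *+ (6 * d.+1) + P *+ (3 * d.+1 ^ 2)
    + (P^`() * 'X^2) *+ (2 * d.+1) - (P * 'X) *+ (2 * d.+1 * d).
  by rewrite /heun; ring.
rewrite !coefB !coefD !coefN !coefMn !coefMXn coefMX !coef_deriv.
case: k => [|[|k]] /=; try rewrite ?subSS ?subn0 ?coef_deriv; ring.
Qed.

(** The operator would raise the degree by one, but the coefficient of X^(d+1)
    picks up the factor d - d. *)
Lemma size_heun (F : comNzRingType) (d : nat) (P : {poly F}) :
  (size P <= d.+1)%N -> (size (heun d P) <= d.+1)%N.
Proof.
move=> /leq_sizeP P0; apply/leq_sizeP => -[//|k] dk.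
have [P1 P2 P3] : [/\ P`_k.+1 = 0, P`_k.+2 = 0 & P`_k.+3 = 0].
  by split; apply: P0; lia.
rewrite coef_heun P1 P2 P3.
move: dk; rewrite ltnS leq_eqVlt => /predU1P[<-|dk]; first ring.
by rewrite P0 //; ring.
Qed.

(** [nabla_coef] over an arbitrary commutative ring. *)
Definition nabla_entry (F : comNzRingType) (d : nat) (alpha : F) (i j : nat) : F :=
  if j == i then 3 * d.+1%:R ^+ 2 * alpha ^+ 2
  else if j.+1 == i then - 4 * (d%:R - i%:R + 2) * d.+1%:R * alpha ^+ 3
  else if j == i.+1 then - 3 * i%:R * d.+1%:R * alpha
  else if j == i.+2 then i%:R * i.+1%:R
  else 0.
Arguments nabla_entry {F}.

(** The entry (i, j) is homogeneous of degree 2 + i - j in alpha, so weighting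
    the coefficients by powers of alpha removes alpha from the equations. *)
Lemma sum_nabla_entry (F : comNzRingType) (d : nat) (alpha : F) (P : {poly F})
  (i : nat) : (size P <= d.+1)%N ->
  \sum_(j < d.+1) nabla_entry d alpha i.+1 j.+1 * (P`_j * (2 * alpha) ^+ j) =
  alpha ^+ 2 * (2 * alpha) ^+ i * (heun d P)`_i.
Proof.
move=> sP.
have out (c : nat -> F) a :
    \sum_(j < d.+1) (if j == a :> nat then c j * P`_j else 0) = c a * P`_a.
  rewrite -big_mkcond (big_ord1_eq _ (fun j => c j * P`_j)); case: ltnP => // h.
  by rewrite nth_default ?mulr0 // (leq_trans sP).
pose t : F := 2 * alpha.
(* The four nonzero diagonals: c0 the main one, c1 and c2 above it, cm below. *)
pose c0 (j : nat) := 3 * d.+1%:R ^+ 2 * alpha ^+ 2 * t ^+ j.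
pose c1 (j : nat) := - 3 * i.+1%:R * d.+1%:R * alpha * t ^+ j.
pose c2 (j : nat) := i.+1%:R * i.+2%:R * t ^+ j.
pose cm (j : nat) := - 4 * (d%:R - i.+1%:R + 2) * d.+1%:R * alpha ^+ 3 * t ^+ j.
rewrite (eq_bigr (fun j : 'I__ => (if j == i :> nat then c0 j * P`_j else 0)
    + (if j == i.+1 :> nat then c1 j * P`_j else 0)
    + (if j == i.+2 :> nat then c2 j * P`_j else 0)
    + (if i is l.+1 then if j == l :> nat then cm j * P`_j else 0 else 0))).
  rewrite !big_split /= !out coef_heun -/t.
  case: i @c0 @c1 @c2 @cm => [|l] c0 c1 c2 cm.
    by rewrite big1_eq /c0 /c1 /c2 !exprS /t; ring.
  rewrite out /c0 /c1 /c2 /cm !exprS.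
  by move: (t ^+ l) => u; rewrite /t; ring.
move=> j _; rewrite /nabla_entry !eqSS.
have -> : (if i is l.+1 then if j == l :> nat then cm j * P`_j else 0 else 0)
    = if j.+1 == i then cm j * P`_j else 0 by case: (i).
rewrite /cm /c0 /c1 /c2 -/t; move: (P`_j) (t ^+ j) => p u.
case: (eqVneq (j : nat) i) => [<-|ji].
  by rewrite (gtn_eqF (ltnSn j)) !ltn_eqF //; ring.
case: (eqVneq j.+1 i) => [<-|ji1].
  by rewrite (ltn_eqF (leqnSn j.+1)) (ltn_eqF (leqW (leqnSn j.+1))); ring.
case: (eqVneq (j : nat) i.+1) => [->|ji2].
  by rewrite ltn_eqF //; ring.
by case: eqP => _; ring.
Qed.

Lemma nabla_eq0_heun (R : realType) (d : nat) (alpha : R[i]) :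
  alpha != 0 -> nabla d alpha = 0 ->
  exists2 P : {poly R[i]}, P != 0 & heun d P = 0.
Proof.
move=> a0; rewrite /nabla -det_tr => /eqP /det0P [v v0 vM].
have t0 : 2%:R * alpha != 0 by rewrite mulf_neq0 ?pnatr_eq0.
pose P := \poly_(j < d.+1) (v 0 (inord j) / (2%:R * alpha) ^+ j).
have Pv (j : 'I_d.+1) : P`_j * (2%:R * alpha) ^+ j = v 0 j.
  by rewrite coef_poly ltn_ord inord_val divfK ?expf_neq0.
have sP : (size P <= d.+1)%N by exact: size_poly.
exists P.
  apply: contraNneq v0 => P0; apply/eqP/rowP => j.
  by rewrite -Pv P0 coef0 mul0r mxE.
apply/polyP => k; rewrite coef0.
have [lk|dk] := ltnP k d.+1.
  have /rowP/(_ (Ordinal lk)) := vM; rewrite !mxE => vk.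
  have := sum_nabla_entry _ d alpha P k sP.
  under eq_bigr => j _ do rewrite Pv.
  rewrite (eq_bigr (fun j => v 0 j * (nabla_mx d alpha)^T j (Ordinal lk))); last first.
    by move=> j _; rewrite !mxE mulrC.
  rewrite vk => /esym/eqP; rewrite !mulf_eq0 !expf_eq0 (negPf a0) (negPf t0).
  by rewrite !andbF /= => /eqP.
by have /leq_sizeP -> := size_heun _ d P sP.
Qed.

(** * Real parts of complex polynomials *)

Section RealPart.
Local Open Scope complex_scope.
Variable R : rcfType.
Local Notation toC := (map_poly (real_complex R)).

Definition re_poly (p : {poly R[i]}) : {poly R} := map_poly (@complex.Re R) p.

Lemma coef_re_poly (p : {poly R[i]}) k : (re_poly p)`_k = complex.Re p`_k.
Proof. exact: coef_map_id0. Qed.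

Lemma re_polyD (p q : {poly R[i]}) : re_poly (p + q) = re_poly p + re_poly q.
Proof.
by apply/polyP => k; rewrite coefD !coef_re_poly coefD; case: p`_k; case: q`_k.
Qed.

Lemma Re_sum I (r : seq I) (f : I -> R[i]) :
  complex.Re (\sum_(i <- r) f i) = \sum_(i <- r) complex.Re (f i).
Proof. by apply: (big_morph (@complex.Re R)) => // -[? ?] [? ?]. Qed.

Lemma Re_realM (x : R) (z : R[i]) : complex.Re (x%:C * z) = x * complex.Re z.
Proof. by case: z => a b /=; rewrite mul0r subr0. Qed.

Lemma re_polyM (p : {poly R}) (q : {poly R[i]}) :
  re_poly (toC p * q) = p * re_poly q.
Proof.
apply/polyP => k; rewrite coef_re_poly !coefM Re_sum.
by apply: eq_bigr => j _; rewrite coef_map Re_realM coef_re_poly.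
Qed.

Lemma re_poly_deriv (p : {poly R[i]}) : re_poly p^`() = (re_poly p)^`().
Proof.
apply/polyP => k; rewrite coef_deriv !coef_re_poly coef_deriv.
by rewrite -mulr_natl -(rmorph_nat (real_complex R)) Re_realM mulr_natl.
Qed.

Lemma horner_re_poly (p : {poly R[i]}) (x : R) :
  (re_poly p).[x] = complex.Re p.[x%:C].
Proof.
rewrite (@horner_coef_wide _ (size p)) ?size_poly // horner_coef Re_sum.
apply: eq_bigr => k _.
by rewrite coef_re_poly -rmorphXn mulrC [in RHS]mulrC Re_realM.
Qed.

Lemma heun_re_poly d (P : {poly R[i]}) : heun d (re_poly P) = re_poly (heun d P).
Proof.
have -> : heun d P = toC 4 * P^`()^`() + toC (2 * d.+1%:R * ('X^2 - 3)) * P^`()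
    + toC (3 * d.+1%:R ^+ 2 - 2 * d.+1%:R * d%:R * 'X) * P.
  rewrite /heun; congr (_ * _ + _ * _ + _ * _);
  by rewrite !(rmorph_nat, rmorphXn, rmorphM, rmorphN, rmorphD) /= ?map_polyX; ring.
by rewrite !re_polyD !re_polyM !re_poly_deriv.
Qed.

(** One of the real and the imaginary part is nonzero; the imaginary part is, up
    to sign, the real part of 'i P. *)
Lemma heun_real_solution d (P : {poly R[i]}) : P != 0 -> heun d P = 0 ->
  exists2 P' : {poly R}, P' != 0 & heun d P' = 0.
Proof.
move=> P0 hP.
have re0 : re_poly (0 : {poly R[i]}) = 0 by apply/polyP => k; rewrite coef_re_poly !coef0.
have [rP|rP] := eqVneq (re_poly P) 0; last first.
  by exists (re_poly P); rewrite // heun_re_poly hP.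
exists (re_poly ('i%:P * P)).
  apply: contra_neq P0 => iP; apply/polyP => k; rewrite coef0.
  have := congr1 (fun p : {poly R} => p`_k) rP.
  have := congr1 (fun p : {poly R} => p`_k) iP.
  rewrite /= !coef_re_poly coefCM !coef0; case: (P`_k) => a b /=.
  by rewrite mul0r mul1r sub0r => /eqP; rewrite oppr_eq0 => /eqP -> ->.
rewrite heun_re_poly; suff -> : heun d ('i%:P * P) = 'i%:P * heun d P by rewrite hP mulr0.
rewrite /heun; move: ('i : R[i]) => u.
rewrite !(derivM, derivC, derivD); ring.
Qed.

End RealPart.
Arguments re_poly {R}.

(** * The equation along a ray *)

Definition ray (F : comNzRingType) (w : F) : {poly F} := 1 + w%:P * 'X.
Arguments ray {F}.

(** Restricted to t = w r, the exponent Phi has derivative (n / 4) times this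
    polynomial in r, when w ^ 3 = -1. *)
Definition gauge (F : comNzRingType) (w : F) : {poly F} :=
  - 'X^2 + (2 * w ^+ 2)%:P * 'X - (2 * w)%:P.
Arguments gauge {F}.

(** For y = exp (Phi) Q, this is 4 exp (- Phi) y'. *)
Definition gauge_deriv (F : comNzRingType) (d : nat) (w : F) (Q : {poly F}) : {poly F} :=
  4 * Q^`() + d.+1%:R * gauge w * Q.
Arguments gauge_deriv {F}.

(** The equation y'' = (n^2 / 16) (r^4 + 4 r^3 conj w) y with the exponential
    divided out; here conj w = 1 - w = - w ^ 2.  The terms of lower order cancel
    since the parameter 3 n^2 makes t = 0 a triple turning point. *)
Lemma gauge_deriv_ode (F : comNzRingType) (d : nat) (w : F) (P : {poly F}) :
  w ^+ 2 = w - 1 -> heun d P = 0 ->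
  let Q := P \Po ray w in
  4 * (gauge_deriv d w Q)^`() + d.+1%:R * gauge w * gauge_deriv d w Q =
  d.+1%:R ^+ 2 * ('X^4 - (4 * w ^+ 2)%:P * 'X^3) * Q.
Proof.
move=> w2 hP /=; set q := ray w.
pose a := P^`()^`() \Po q; pose b := P^`() \Po q; pose c := P \Po q.
have ode : 4 * a + 2 * d.+1%:R * (q ^+ 2 - 3) * b
    + (3 * d.+1%:R ^+ 2 - 2 * d.+1%:R * d%:R * q) * c = 0.
  rewrite -(rmorph0 (comp_poly q)) -hP /heun.
  rewrite !(rmorph_nat, rmorphXn, rmorphM, rmorphN, rmorphD) /= comp_polyX.
  by rewrite -/a -/b -/c; ring.
have dray : q^`() = w%:P.
  by rewrite /q /ray -[1]/(1%:P) !derivE; ring.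
have dc : c^`() = b * w%:P by rewrite /c deriv_comp dray.
have db : b^`() = a * w%:P by rewrite /b deriv_comp dray.
have ddamp : (gauge w)^`() = - 2 * 'X + 2 * w%:P ^+ 2.
  by rewrite /gauge !derivE; ring.
have dnat k : (k%:R : {poly F})^`() = 0 by rewrite -polyC_natr derivC.
rewrite -/c /gauge_deriv derivD !derivM !dnat dc derivM db derivC ddamp.
have w3 : w%:P ^+ 3 + 1 = 0 :> {poly F}.
  by rewrite -rmorphXn -[1]/(1%:P) -rmorphD /= exprS w2 mulrBr -expr2 w2; congr _%:P; ring.
apply/eqP; rewrite -subr_eq0; apply/eqP.
(* The difference of the two sides is 4 w^2 times the equation for P plus a
   multiple of w^3 + 1. *)
transitivity (4 * w%:P ^+ 2 * (4 * a + 2 * d.+1%:R * (q ^+ 2 - 3) * b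
    + (3 * d.+1%:R ^+ 2 - 2 * d.+1%:R * d%:R * q) * c)
  + (w%:P ^+ 3 + 1) * (- 8 * d.+1%:R * w%:P * 'X^2 * b
   + c * (- 8 * d.+1%:R * 'X + 4 * d.+1%:R ^+ 2 * w%:P * 'X^2))); last first.
  by rewrite ode w3 mulr0 mul0r addr0.
by rewrite /q /ray /gauge; ring.
Qed.

(** Here Q and Qb are the polynomial parts of y and conj y.  As w ^ 2 + (1 - w) ^ 2 = -1 and w + (1 - w) = 1, the exponents
    of y and conj y add up to a polynomial with rational coefficients: the last
    term is a real multiple of the energy itself. *)
Lemma energy_deriv (F : comNzRingType) (d : nat) (w : F) (Q Qb : {poly F}) :
  w ^+ 2 = w - 1 ->
  4 * (gauge_deriv d w Q)^`() + d.+1%:R * gauge w * gauge_deriv d w Q =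
    d.+1%:R ^+ 2 * ('X^4 - (4 * w ^+ 2)%:P * 'X^3) * Q ->
  4 * ((1 + w)%:P * (Qb * gauge_deriv d w Q))^`() =
    (1 + w)%:P * (gauge_deriv d (1 - w) Qb * gauge_deriv d w Q)
    + d.+1%:R ^+ 2 * ((1 + w)%:P * 'X^4 + (4 * (2 - w))%:P * 'X^3) * (Qb * Q)
    + 2 * d.+1%:R * ('X^2 + 'X + 1) * ((1 + w)%:P * (Qb * gauge_deriv d w Q)).
Proof.
move=> w2 dU.
have w3 : w%:P ^+ 2 - w%:P + 1 = 0 :> {poly F}.
  by rewrite -rmorphXn /= w2 rmorphB /= polyC1; ring.
rewrite !derivM derivC; set U := gauge_deriv d w Q in dU *.
set U' := U^`() in dU *.
transitivity ((1 + w)%:P * Qb * (4 * U' + d.+1%:R * gauge w * U)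
  + (1 + w)%:P * (4 * Qb^`() * U - Qb * (d.+1%:R * gauge w * U))); first ring.
rewrite dU /gauge_deriv.
apply/eqP; rewrite -subr_eq0; apply/eqP.
(* What is left lies in the ideal of w^2 - w + 1. *)
transitivity ((w%:P ^+ 2 - w%:P + 1) * (- 4 * (2 + w%:P) * d.+1%:R ^+ 2 * 'X^3 * Qb * Q
   - 4 * d.+1%:R * (1 + w%:P) * 'X * Qb * U)); last by rewrite w3 mul0r.
by rewrite /gauge; ring.
Qed.

Lemma energy_deriv_at (F : comNzRingType) (d : nat) (w : F) (Q Qb : {poly F}) (x : F) :
  w ^+ 2 = w - 1 ->
  4 * (gauge_deriv d w Q)^`() + d.+1%:R * gauge w * gauge_deriv d w Q =
    d.+1%:R ^+ 2 * ('X^4 - (4 * w ^+ 2)%:P * 'X^3) * Q ->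
  4 * ((1 + w)%:P * (Qb * gauge_deriv d w Q))^`().[x] =
    (1 + w) * ((gauge_deriv d (1 - w) Qb).[x] * (gauge_deriv d w Q).[x])
    + d.+1%:R ^+ 2 * ((1 + w) * x ^+ 4 + 4 * (2 - w) * x ^+ 3) * (Qb.[x] * Q.[x])
    + 2 * d.+1%:R * (x ^+ 2 + x + 1) * ((1 + w)%:P * (Qb * gauge_deriv d w Q)).[x].
Proof.
move=> w2 /(energy_deriv _ _ _ _ Qb w2); move: (_ * (Qb * _)) => J.
move: (gauge_deriv d w Q) (gauge_deriv d (1 - w) Qb) => U Ub /(congr1 (horner^~ x)).
have nat k : (k%:R : {poly F}).[x] = k%:R by rewrite -polyC_natr hornerC.
by rewrite !(nat, hornerD, hornerM, hornerXn, hornerX, hornerC).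
Qed.

Lemma horner_gauge_deriv0 (F : comNzRingType) d (w : F) (Q : {poly F}) :
  (gauge_deriv d w Q).[0] = 4 * Q^`().[0] - 2 * d.+1%:R * w * Q.[0].
Proof.
have nat k : (k%:R : {poly F}).[0] = k%:R by rewrite -polyC_natr hornerC.
rewrite /gauge_deriv /gauge !(nat, hornerD, hornerN, hornerM, hornerXn, hornerX, hornerC).
ring.
Qed.

(** * Energy along the ray of argument pi / 3 *)

Section Energy.
Local Open Scope complex_scope.

Definition omega (R : rcfType) : R[i] := 2^-1 +i* (Num.sqrt 3 / 2).
Arguments omega {R}.

Lemma omega2 (R : rcfType) : omega ^+ 2 = omega - 1 :> R[i].
Proof.
have s3 : Num.sqrt 3 ^+ 2 = 3 :> R by rewrite sqr_sqrtr.
by rewrite expr2; apply/eqP; rewrite eq_complex /=; apply/andP; split; apply/eqP; field: s3.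
Qed.

Lemma conj_omega (R : rcfType) : conjc omega = 1 - omega :> R[i].
Proof.
by apply/eqP; rewrite eq_complex /=; apply/andP; split; apply/eqP; field.
Qed.

Lemma conj_gauge_deriv (R : rcfType) d (w : R[i]) (Q : {poly R[i]}) :
  map_poly conjc (gauge_deriv d w Q) = gauge_deriv d (conjc w) (map_poly conjc Q).
Proof.
rewrite /gauge_deriv /gauge !(rmorph_nat, rmorphXn, rmorphM, rmorphN, rmorphD) /=.
by rewrite deriv_map !map_polyX !map_polyC.
Qed.

(** The energy H satisfies the hypotheses of [eq0_of_deriv_ge], so it is zero,
    and its derivative then forces Q = 0 at all positive reals. *)
Lemma heun_poly_eq0 (R : realType) (d : nat) (P : {poly R}) :
  heun d P = 0 -> P = 0.
Proof.
move=> hP; pose toC := map_poly (real_complex R); pose w : R[i] := omega.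
have w2 : w ^+ 2 = w - 1 := omega2 R.
have wc : conjc w = 1 - w := conj_omega R.
have hPC : heun d (toC P) = 0.
  rewrite -[RHS](rmorph0 toC) -hP /toC /heun.
  rewrite !(rmorph_nat, rmorphXn, rmorphM, rmorphN, rmorphD) /= map_polyX.
  by rewrite !deriv_map; ring.
pose Q := toC P \Po ray w; pose U := gauge_deriv d w Q.
pose Qb := map_poly conjc Q; pose Ub := gauge_deriv d (1 - w) Qb.
have UbE : Ub = map_poly conjc U by rewrite conj_gauge_deriv wc.
have := fun x => energy_deriv_at _ d w Q Qb x w2 (gauge_deriv_ode _ d w _ w2 hPC).
rewrite -/U -/Ub UbE; move defJ: ((1 + w)%:P * (Qb * U)) => J dJ.
pose H := re_poly J.
pose sq (z : R[i]) := complex.Re z ^+ 2 + complex.Im z ^+ 2.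
have sq_ge0 z : 0 <= sq z by rewrite addr_ge0 ?sqr_ge0.
have conjM z : conjc z * z = (sq z)%:C.
  by case: z => x y; apply/eqP; rewrite /sq eq_complex /=; apply/andP; split; apply/eqP; ring.
have conj_horner (p : {poly R[i]}) (x : R) :
    (map_poly conjc p).[x%:C] = conjc p.[x%:C].
  by rewrite -horner_map /= oppr0.
have ReD (z z' : R[i]) : complex.Re (z + z') = complex.Re z + complex.Re z'.
  by case: z; case: z'.
pose n : R := d.+1%:R.
(* The two real parts Re (1 + w) and Re (2 - w) are 3 / 2. *)
have dH x : 4 * H^`().[x] = 3 / 2 * (sq U.[x%:C]
    + n ^+ 2 * (x ^+ 4 + 4 * x ^+ 3) * sq Q.[x%:C])
    + 2 * n * (x ^+ 2 + x + 1) * H.[x].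
  rewrite -re_poly_deriv !horner_re_poly -!Re_realM.
  have := dJ x%:C; rewrite /Qb !conj_horner.
  set j' := J^`().[_]; set j := J.[_]; set u := U.[_]; set q := Q.[_] => dj.
  suff -> : (4 : R)%:C * j' = (sq u)%:C * (1 + w)
      + (n ^+ 2 * x ^+ 4 * sq q)%:C * (1 + w)
      + (4 * n ^+ 2 * x ^+ 3 * sq q)%:C * (2 - w)
      + (2 * n * (x ^+ 2 + x + 1))%:C * j.
    have Rew : complex.Re (1 + w) = 3 / 2 by rewrite ReD /=; field.
    have Re2w : complex.Re (2 - w) = 3 / 2 by rewrite !ReD /=; field.
    by rewrite !ReD !Re_realM Rew Re2w; field.
  transitivity (4 * j'); first by rewrite rmorph_nat.
  rewrite dj !conjM /n; move: (sq u) (sq q) => su sq'.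
  rewrite !(rmorph_nat, rmorphXn, rmorphM, rmorphN, rmorphD) /=.
  by ring.
(* E is - 2 Re Phi on the ray. *)
pose E : {poly R} := (n / 12)%:P * (2 * 'X^3 + 3 * 'X^2 + 6 * 'X).
have dE : E^`() = (n / 12 * 6)%:P * ('X^2 + ('X + 1%:P)).
  have nat k : k%:R = (k%:R)%:P :> {poly R} by rewrite polyC_natr.
  by rewrite /E !nat !derivE; ring.
have n0 : 0 < n by rewrite ltr0n.
have H0 : H = 0.
  apply: (@eq0_of_deriv_ge _ E).
  - rewrite dE lead_coefM lead_coefC lead_coefDl ?size_polyXn ?size_XaddC //.
    by rewrite lead_coefXn; lra.
  - (* At the turning point y is real and y' is a real multiple of w, while
       (1 + w) w = 2 w - 1 is purely imaginary. *)
    have real_at0 (p : {poly R}) : (toC p \Po ray w).[0] = p.[1]%:C.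
      rewrite horner_comp /ray hornerD hornerM hornerX mulr0 hornerC addr0.
      by rewrite -(rmorph1 (real_complex R)) horner_map.
    have dQ0 : Q^`().[0] = P^`().[1]%:C * w.
      rewrite deriv_comp hornerM deriv_map real_at0; congr (_ * _).
      by rewrite /ray -[1]/(1%:P) !derivE !hornerE.
    have Uw : U.[0] = (4 * P^`().[1] - 2 * n * P.[1])%:C * w.
      have := @horner_gauge_deriv0 _ d w Q.
      rewrite -/U dQ0 real_at0 => ->.
      rewrite !(rmorph_nat, rmorphXn, rmorphM, rmorphN, rmorphD) /=; ring.
    rewrite horner_re_poly -defJ rmorph0 !hornerM hornerC Uw.
    have := conj_horner Q 0; rewrite rmorph0 -/Qb => ->; rewrite real_at0.
    set a := P.[1]; set b := 4 * _ - _.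
    have -> : (1 + w) * (conjc a%:C * (b%:C * w)) = (a * b)%:C * (2 * w - 1).
      rewrite conjc_real rmorphM /=; move: (a%:C) (b%:C) => a' b'.
      transitivity (a' * b' * (w + w ^+ 2)); first ring.
      by rewrite w2; ring.
    by rewrite Re_realM ReD mulr_natl /=; lra.
  - move=> x x0; rewrite dE !(hornerM, hornerD, hornerXn, hornerX, hornerC) -subr_ge0.
    suff -> : H^`().[x] - n / 12 * 6 * (x ^+ 2 + (x + 1)) * H.[x] = 3 / 8 * (sq U.[x%:C]
    + n ^+ 2 * (x ^+ 4 + 4 * x ^+ 3) * sq Q.[x%:C]).
      apply: mulr_ge0; first by lra.
      rewrite addr_ge0 ?sq_ge0 // !mulr_ge0 ?sq_ge0 ?sqr_ge0 //.
      by rewrite addr_ge0 ?mulr_ge0 ?exprn_ge0 ?ler0n.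
    by apply: (@mulfI _ 4); rewrite ?pnatr_eq0 // mulrBr dH; field.
have Q0 : Q = 0.
  apply: eq0_of_horner_nat => k.
  have := dH k.+1%:R; rewrite H0 deriv0 !horner0 !mulr0 addr0 rmorph_nat.
  set x : R := k.+1%:R; set q := Q.[_]; set u := U.[_] => /esym/eqP.
  have x0 : 0 < x by rewrite ltr0n.
  have c0 : 0 < n ^+ 2 * (x ^+ 4 + 4 * x ^+ 3).
    by rewrite mulr_gt0 ?exprn_gt0 // addr_gt0 ?mulr_gt0 ?exprn_gt0.
  rewrite mulf_eq0 paddr_eq0 ?(mulr_ge0 (ltW c0)) //.
  case/orP; first by rewrite mulf_eq0 invr_eq0 !pnatr_eq0.
  case/andP=> _; rewrite mulf_eq0 gt_eqF //= paddr_eq0 ?sqr_ge0 // !sqrf_eq0.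
  by case: q => a b /= /andP[/eqP -> /eqP ->].
move/eqP: Q0; rewrite comp_poly_eq0; first by rewrite map_poly_eq0 => /eqP.
rewrite /ray addrC -polyC1 size_MXaddC polyC_eq0 oner_eq0 andbF size_polyC.
by rewrite eq_complex /= invr_eq0 pnatr_eq0.
Qed.

End Energy.

Theorem lemma2 (R : realType) (d : nat) (alpha : R[i]) (halpha : alpha <> 0) :
  nabla d alpha <> 0.
Proof.
have a0 : alpha != 0 by apply/eqP.
move=> /(nabla_eq0_heun _ _ _ a0)[P P0 /(heun_real_solution _ _ _ P0)[P' P'0 hP']].
by rewrite (heun_poly_eq0 _ _ _ hP') eqxx in P'0.
Qed.
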